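(* Let $(X,d)$ be a compact metric space and let $f\colon X\to X$ be a homeomorphism with the L-shadowing property. Then for each $\varepsilon>0$ there is $\delta>0$ such that for each $r>0$ there exists a positive integer $k_r$ such that: if $x,y\in X$ satisfy $d(x,y)<\delta$, then there is $z\in V^s_\varepsilon(x)\cap V^u_\varepsilon(y)$ satisfying $$f^{k_r}(z)\in V^s_r(f^{k_r}(x))\quad\text{and}\quad f^{-k_r}(z)\in V^u_r(f^{-k_r}(y)).$$
   Context: The homeomorphism $f$ has the L-shadowing property if for every $\varepsilon>0$ there exists $\delta>0$ such that for every sequence $(x_k)_{k\in\mathbb{Z}}\subset X$ satisfying $d(f(x_k),x_{k+1})\le\delta$ for every $k\in\mathbb{Z}$ and $\lim_{|k|\to\infty}d(f(x_k),x_{k+1})=0$, there is $z\in X$ satisfying $d(f^k(z),x_k)\le\varepsilon$ for every $k\in\mathbb{Z}$ and $\lim_{|k|\to\infty}d(f^k(z),x_k)=0$. For $x\in X$ and $c>0$: $W^s_c(x)=\{y\in X: d(f^k(y),f^k(x))\le c \text{ for every } k\ge 0\}$, $W^u_c(x)=\{y\in X: d(f^k(y),f^k(x))\le c \text{ for every } k\le 0\}$, $W^s(x)=\{y\in X: d(f^k(y),f^k(x))\to 0 \text{ as } k\to\infty\}$, $W^u(x)=\{y\in X: d(f^k(y),f^k(x))\to 0 \text{ as } k\to-\infty\}$, $V^s_c(x)=W^s(x)\cap W^s_c(x)$ and $V^u_c(x)=W^u(x)\cap W^u_c(x)$. *)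

(* Defs.v *)
From mathcomp Require Import all_boot all_order all_algebra.
From mathcomp Require Import all_classical all_reals all_analysis.

Set Implicit Arguments.
Unset Strict Implicit.
Unset Printing Implicit Defensive.

Import Order.TTheory GRing.Theory Num.Theory.
Import numFieldNormedType.Exports.

Local Open Scope classical_set_scope.
Local Open Scope ring_scope.

Record homeo (X : topologicalType) := Homeo {
  homeo_fun :> X -> X;
  homeo_inv : X -> X;
  homeo_funK : cancel homeo_fun homeo_inv;
  homeo_invK : cancel homeo_inv homeo_fun;
  homeo_continuous : continuous homeo_fun;
  homeo_inv_continuous : continuous homeo_inv }.

(* The iterate f^k for k : int; recall that Negz n is -(n + 1). *)
Definition iterz (X : topologicalType) (f : homeo X) (k : int) (x : X) : X :=
  match k with
  | Posz n => iter n f x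
  | Negz n => iter n.+1 (homeo_inv f) x
  end.

Lemma iterzD1 (X : topologicalType) (f : homeo X) (k : int) (x : X) :
  iterz f (k + 1) x = f (iterz f k x).
Proof.
case: k => [n|n]; first by rewrite -PoszD addn1.
have -> : Negz n + 1 = - n%:Z by rewrite NegzE -addn1 PoszD opprD addrNK.
by case: n => [|n] /=; rewrite -?NegzE ?oppr0 /= homeo_invK.
Qed.

(* The filter of "|k| --> oo" on the integers. *)
Definition absz_oo : set_system int :=
  filter_from [set: nat] (fun N => [set k : int | (N <= `|k|)%N]).

Global Instance absz_oo_filter : ProperFilter absz_oo.
Proof.
apply: filter_from_proper => [|N _]; last by exists N%:Z => /=.
apply: filter_from_filter; first by exists 0%N.
move=> M N _ _; exists (maxn M N) => // k /=.
by rewrite geq_max => /andP[].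
Qed.

Definition L_shadowing (R : realType) (X : metricType R) (f : homeo X) : Prop :=
  forall e : R, 0 < e -> exists2 d : R, 0 < d &
    forall x : int -> X,
      (forall k : int, mdist (f (x k)) (x (k + 1)) <= d) ->
      mdist (f (x k)) (x (k + 1)) @[k --> absz_oo] --> (0 : R) ->
      exists z : X,
        (forall k : int, mdist (iterz f k z) (x k) <= e) /\
        mdist (iterz f k z) (x k) @[k --> absz_oo] --> (0 : R).

Section StableUnstableSets.
Context {R : realType} {X : metricType R} (f : homeo X).
Implicit Types (c : R) (x : X).

Definition Ws_loc c x : set X :=
  [set y | forall k : int, 0 <= k -> mdist (iterz f k y) (iterz f k x) <= c].

Definition Wu_loc c x : set X :=
  [set y | forall k : int, k <= 0 -> mdist (iterz f k y) (iterz f k x) <= c].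

Definition Ws x : set X :=
  [set y | mdist (iterz f n%:Z y) (iterz f n%:Z x) @[n --> \oo] --> (0 : R)].

Definition Wu x : set X :=
  [set y | mdist (iterz f (- n%:Z) y) (iterz f (- n%:Z) x)
             @[n --> \oo] --> (0 : R)].

Definition Vs c x : set X := Ws x `&` Ws_loc c x.

Definition Vu c x : set X := Wu x `&` Wu_loc c x.

End StableUnstableSets.

(* Main.v *)
(** The pseudo-orbit following y in the past and x in the future has a single
jump, of size d(x, y), so it is L-shadowed by some z in V^s(x) and V^u(y).  For
pairs (x', y') near (x, y), the pseudo-orbit following y' up to time -N, then z
up to time N, then x', has jumps only at -N and N.  They are small once N is
large and (x', y') is close enough to (x, y); L-shadowing with precision
min(r, e/3) gives a point z' that is e-close to the orbits of x' and y' and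
r-close to them from time N on.  Thus every time past N works locally around
(x, y), and compactness of X * X makes it uniform. *)
Require Import Defs.
From mathcomp Require Import all_boot all_order all_algebra.
From mathcomp Require Import all_classical all_reals all_analysis.
From mathcomp Require Import zify lra.

Set Implicit Arguments.
Unset Strict Implicit.
Unset Printing Implicit Defensive.

Import Order.TTheory GRing.Theory Num.Theory.
Import numFieldNormedType.Exports.

Local Open Scope classical_set_scope.
Local Open Scope ring_scope.

Section Iterates.
Context {X : topologicalType} (f : homeo X).

Lemma iterzB1 (k : int) (x : X) :
  iterz f (k - 1) x = homeo_inv f (iterz f k x).
Proof. by rewrite -{2}(subrK 1 k) iterzD1 homeo_funK. Qed.

Lemma iterzD (k m : int) (x : X) :
  iterz f (k + m) x = iterz f k (iterz f m x).
Proof.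
elim: k => [|n IHn|n IHn]; first by rewrite add0r.
  by rewrite -addn1 PoszD addrAC !iterzD1 IHn.
have -> : - n.+1%:Z = - n%:Z - 1 by lia.
by rewrite addrAC !iterzB1 IHn.
Qed.

Lemma iterz_continuous (k : int) : continuous (iterz f k).
Proof.
have iter_continuous (g : X -> X) : continuous g -> forall n, continuous (iter n g).
  move=> gcont; elim=> [|n IHn] x; first exact: cvg_id.
  by apply: continuous_comp; [exact: IHn | exact: gcont].
case: k => n /=; first exact/iter_continuous/homeo_continuous.
exact: (iter_continuous _ (@homeo_inv_continuous _ f) n.+1).
Qed.

End Iterates.

Lemma cvg_Posz_absz_oo : Posz n @[n --> \oo] --> absz_oo.
Proof. by move=> P [N _ NP]; exists N => // n /= Nn; apply: NP. Qed.

Lemma cvg_oppz_absz_oo : - Posz n @[n --> \oo] --> absz_oo.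
Proof. by move=> P [N _ NP]; exists N => // n /= Nn; apply: NP => /=; lia. Qed.

Section Splicing.
Context {R : realType} {X : metricType R} (f : homeo X).
Implicit Types (a b c x y z : X) (e r : R) (m n k : int).

Lemma Ws_iter x z (N : nat) :
  Ws f x z -> Ws f (iterz f N x) (iterz f N z).
Proof.
move=> xz; rewrite /Ws /mkset; under eq_fun do rewrite -!iterzD -PoszD.
exact: (cvg_comp _ _ (cvg_addnr N) xz).
Qed.

Lemma Wu_iter x z (N : nat) :
  Wu f x z -> Wu f (iterz f (- N%:Z) x) (iterz f (- N%:Z) z).
Proof.
move=> xz; rewrite /Wu /mkset.
under eq_fun do rewrite -!iterzD -opprD -PoszD.
exact: (cvg_comp _ _ (cvg_addnr N) xz).
Qed.

(** The concatenation of three orbit segments is an exact orbit except on entering times [m] and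
    [n]; its errors vanish for large [|k|], so L-shadowing applies to it. *)
Lemma shadow_splice : L_shadowing f -> forall r, 0 < r -> exists2 d : R, 0 < d &
  forall a b c m n, m < n ->
    mdist (iterz f m a) (iterz f m b) <= d ->
    mdist (iterz f n b) (iterz f n c) <= d ->
    exists z, [/\
      forall k, k < m -> mdist (iterz f k z) (iterz f k a) <= r,
      forall k, m <= k -> k < n -> mdist (iterz f k z) (iterz f k b) <= r,
      forall k, n <= k -> mdist (iterz f k z) (iterz f k c) <= r,
      Wu f a z & Ws f c z].
Proof.
move=> shadow_f r r0; have [d d0 shadow_d] := shadow_f r r0.
exists d => // a b c m n mn dab dbc.
pose w k := if k < m then iterz f k a else
            if k < n then iterz f k b else iterz f k c.
have w_lt k : k < m -> w k = iterz f k a by rewrite /w => ->.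
have w_mid k : m <= k -> k < n -> w k = iterz f k b.
  by rewrite /w => mk ->; rewrite ltNge mk.
have w_ge k : n <= k -> w k = iterz f k c.
  by rewrite /w => nk; rewrite !ltNge nk (le_trans (ltW mn) nk).
have jump0 k : k + 1 != m -> k + 1 != n -> mdist (f (w k)) (w (k + 1)) = 0.
  move=> km kn; case: (ltP k m) => mk.
    by rewrite !w_lt -?iterzD1 ?mdistxx //; lia.
  case: (ltP k n) => nk; first by rewrite !w_mid -?iterzD1 ?mdistxx //; lia.
  by rewrite !w_ge -?iterzD1 ?mdistxx //; lia.
have [||z [zw zw0]] := shadow_d w.
- move=> k; have [km|km] := eqVneq (k + 1) m.
    by rewrite w_lt ?w_mid -?iterzD1 ?km //; lia.
  have [kn|kn] := eqVneq (k + 1) n.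
    by rewrite w_mid ?w_ge -?iterzD1 ?kn //; lia.
  by rewrite jump0 // ltW.
- apply: cvg_near_cst; exists (`|m| + `|n| + 2)%N => // k /= kN.
  by apply: jump0; lia.
exists z; split.
- by move=> k km; rewrite -w_lt.
- by move=> k mk kn; rewrite -w_mid.
- by move=> k nk; rewrite -w_ge.
(* The two-sided limit restricts to each end of the integers, where [w] coincides with the orbit of
   [a], respectively [c]. *)
- rewrite /Wu /mkset; move: (cvg_comp _ _ cvg_oppz_absz_oo zw0).
  apply: cvg_trans; apply: near_eq_cvg; exists `|m|.+1 => // k /= mk.
  by rewrite w_lt //; lia.
- rewrite /Ws /mkset; move: (cvg_comp _ _ cvg_Posz_absz_oo zw0).
  apply: cvg_trans; apply: near_eq_cvg; exists `|n|%N => // k /= nk.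
  by rewrite w_ge //; lia.
Qed.

Lemma near_iterz_close x (N : nat) r : 0 < r -> \forall x' \near x,
  forall k, (`|k| <= N)%N -> mdist (iterz f k x) (iterz f k x') < r.
Proof.
move=> r0.
have near1 k : \forall x' \near x, mdist (iterz f k x) (iterz f k x') < r.
  exact: (metricType_numDomainType.cvgr_dist_lt (@iterz_continuous _ f k x) r0).
elim: N => [|N IHN]; near=> x' => k kN.
  have -> : k = 0 by lia.
  by near: x'; exact: near1.
have [|Nk] := leqP `|k| N; first by move: (k); near: x'.
have [->|->] : k = N.+1%:Z \/ k = - N.+1%:Z by lia.
  by near: x'; exact: near1.
by near: x'; exact: near1.
Unshelve. all: by end_near. Qed.

Lemma shadow_bracket : L_shadowing f -> forall e, 0 < e ->
  exists2 d : R, 0 < d &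
    forall x y, mdist x y <= d -> exists z, (Vs f e x `&` Vu f e y) z.
Proof.
move=> shadow_f e e0.
have [d d0 splice] := shadow_splice shadow_f (divr_gt0 e0 (ltr0n _ 2)).
exists (Num.min d (e / 2)); first by rewrite lt_min d0 divr_gt0.
move=> x y; rewrite le_min => /andP[xyd xye].
(* Repeating [x] makes the jump at time 1 trivial; only the one from [y] to [x] at time 0
   remains. *)
have [|||z [zy zx0 zx1 Wuz Wsz]] := splice y x x 0 1.
- by [].
- by rewrite metric_sym.
- by rewrite mdistxx ltW.
have zx k : 0 <= k -> mdist (iterz f k z) (iterz f k x) <= e / 2.
  by move=> k0; case: (ltP k 1) => k1; [exact: zx0 | exact: zx1].
exists z; split; split => // k k0.
  by have := zx k k0; lra.
(* At time 0 the spliced sequence is at [x], not [y]: the bound there costs [e / 2] for [z] to [x]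
   and [e / 2] for [x] to [y]. *)
move: k0; rewrite le_eqVlt => /predU1P[->|/zy zyk]; last by lra.
by have := zx 0 (lexx _); have := metric_triangle z x y; rewrite /=; lra.
Qed.

(** The thirds of [e] pay for the distances from [z'] to [z], from [z] to [x] or [y], and from there
    to the perturbed point. The joint nearness in [p] and [i] is the form that the compactness
    argument consumes. *)
Lemma bracket_near x y z e r : L_shadowing f -> 0 < e -> 0 < r ->
  (Vs f (e / 3) x `&` Vu f (e / 3) y) z ->
  \forall p \near (x, y) & i \near \oo, exists z',
    [/\ (Vs f e p.1 `&` Vu f e p.2) z',
        Vs f r (iterz f i%:Z p.1) (iterz f i%:Z z') &
        Vu f r (iterz f (- i%:Z) p.2) (iterz f (- i%:Z) z')].
Proof.
move=> shadow_f e0 r0 [[Wsz zx] [Wuz zy]].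
pose s := Num.min r (e / 3).
have s0 : 0 < s by rewrite lt_min r0 divr_gt0.
have /andP[sr se] : (s <= r) && (s <= e / 3) by rewrite -le_min.
have [d d0 splice] := shadow_splice shadow_f s0.
(* Each jump splits into two halves of [d]: asymptoticity of [z] at times [N] and [- N], and
   continuity of the iterates. *)
pose t := Num.min (d / 2) (e / 3).
have t0 : 0 < t by rewrite lt_min !divr_gt0.
have /andP[td te] : (t <= d / 2) && (t <= e / 3) by rewrite -le_min.
have d20 : 0 < d / 2 by rewrite divr_gt0.
have /cvgrPdist_lt/(_ _ d20)[N1 _ N1P] := Wsz.
have /cvgrPdist_lt/(_ _ d20)[N2 _ N2P] := Wuz.
have [N [N0 zxN zyN]] : exists N : nat, [/\ (0 < N)%N,
    mdist (iterz f N z) (iterz f N x) < d / 2 &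
    mdist (iterz f (- N%:Z) z) (iterz f (- N%:Z) y) < d / 2].
  exists (N1 + N2).+1; split=> //.
    have := N1P (N1 + N2).+1; rewrite sub0r normrN ger0_norm ?mdist_ge0 //.
    by apply; exact/leqW/leq_addr.
  have := N2P (N1 + N2).+1; rewrite sub0r normrN ger0_norm ?mdist_ge0 //.
  by apply; exact/leqW/leq_addl.
pose close u := [set u' | forall k, (`|k| <= N)%N ->
  mdist (iterz f k u) (iterz f k u') < t].
(* The inequality [N < i] is strict because the splice follows [y'] only at times strictly before
   [- N]. *)
exists (close x `*` close y, [set i | (N < i)%N]).
  split; last by exists N.+1.
  by exists (close x, close y) => //; split; exact: near_iterz_close.
move=> [[x' y'] i] [[/= xx' yy'] /= Ni].
have [|||z' [z'y z'z z'x Wuz' Wsz']] := splice y' z x' (- N%:Z) N.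
- by clear -N0; lia.
- have := yy' (- N%:Z); rewrite abszN => /(_ (leqnn _)).
  have := metric_triangle (iterz f (- N%:Z) z) (iterz f (- N%:Z) y)
    (iterz f (- N%:Z) y').
  by rewrite [mdist (iterz f _ y') _]metric_sym; lra.
- have := xx' N (leqnn _).
  by have := metric_triangle (iterz f N z) (iterz f N x) (iterz f N x'); lra.
have through u u' k : mdist (iterz f k z') (iterz f k z) <= s ->
    mdist (iterz f k z) (iterz f k u) <= e / 3 ->
    mdist (iterz f k u) (iterz f k u') < t ->
    mdist (iterz f k z') (iterz f k u') <= e.
  have := metric_triangle (iterz f k z') (iterz f k z) (iterz f k u').
  by have := metric_triangle (iterz f k z) (iterz f k u) (iterz f k u'); lra.
exists z'; split; split.
- split=> // k k0; case: (ltP k N) => kN.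
    by apply: (through x); [apply: z'z | exact: zx | apply: xx']; clear -k0 kN; lia.
  by rewrite (le_trans (z'x _ kN)) //; lra.
- split=> // k k0; case: (ltP k (- N%:Z)) => kN.
    by rewrite (le_trans (z'y _ kN)) //; lra.
  by apply: (through y); [apply: z'z | exact: zy | apply: yy']; clear -k0 kN N0; lia.
- exact: Ws_iter.
- by move=> k k0; rewrite -!(iterzD f k i%:Z) (le_trans (z'x _ _)) //; clear -k0 Ni; lia.
- exact: Wu_iter.
- by move=> k k0; rewrite -!(iterzD f k (- i%:Z)) (le_trans (z'y _ _)) //; clear -k0 Ni; lia.
Qed.

End Splicing.

Theorem theorem2 (R : realType) (X : metricType R) (f : homeo X)
    (compactX : compact [set: X]) (shadow_f : L_shadowing f) :
  forall e : R, 0 < e -> exists2 d : R, 0 < d &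
    forall r : R, 0 < r -> exists2 kr : nat, (0 < kr)%N &
      forall x y : X, mdist x y < d ->
        exists z : X,
          [/\ (Vs f e x `&` Vu f e y) z,
              Vs f r (iterz f kr%:Z x) (iterz f kr%:Z z) &
              Vu f r (iterz f (- kr%:Z) y) (iterz f (- kr%:Z) z)].
Proof.
move=> e e0.
have [d d0 bracket] := shadow_bracket shadow_f (divr_gt0 e0 (ltr0n _ 3)).
(* Halving [d] leaves a margin: pairs near one at distance more than [d] are still more than [d / 2]
   apart. *)
exists (d / 2); first by rewrite divr_gt0.
move=> r r0.
(* With the distance bound as a premise, the covering argument runs over the whole compact
   product. *)
pose good (i : nat) (p : X * X) := mdist p.1 p.2 < d / 2 -> exists z,
  [/\ (Vs f e p.1 `&` Vu f e p.2) z,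
      Vs f r (iterz f i%:Z p.1) (iterz f i%:Z z) &
      Vu f r (iterz f (- i%:Z) p.2) (iterz f (- i%:Z) z)].
have : compact [set: X * X] by rewrite -setXTT; exact: compact_setX.
move=> /compact_near_coveringP /(_ nat \oo good _) [[x y] _|N _ Ngood]; last first.
  by exists N.+1 => // x y xy; exact: (Ngood N.+1 (leqnSn _) (x, y)).
have [/bracket[z xyz]|dxy] := leP (mdist x y) d.
  by apply: filterS (bracket_near shadow_f e0 r0 xyz) => p + _.
(* For a far pair, moving each point by less than [d / 4] keeps the premise of [good] false. *)
have near_q (u : X) : nbhs u [set v | mdist u v < d / 4].
  by rewrite -ballEmdist; apply: nbhsx_ballx; rewrite divr_gt0.
exists ([set x' | mdist x x' < d / 4] `*` [set y' | mdist y y' < d / 4], setT).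
  split; last exact: filterT.
  by exists ([set x' | mdist x x' < d / 4], [set y' | mdist y y' < d / 4]).
move=> [[x' y'] i] [[/= xx' yy'] _]; rewrite /good /= => xy'; exfalso.
have := metric_triangle x x' y; have := metric_triangle x' y' y.
by rewrite [mdist y' y]metric_sym; lra.
Qed.
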